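(* Let $G$ be an $n\times n$ grid with $n$ even. Every initial configuration of $k\ge3$ robots on distinct nodes of $G$ in which exactly three corners of the minimum enclosing square are occupied is gatherable despite at most one crash fault.
   Context: Model. The grid is the anonymous grid graph. A configuration is $f:V(G)\to\{0,1,2\}$ ($0$ empty, $1$ singleton, $2$ multiplicity). Robots are anonymous, identical, oblivious, cannot communicate, share no coordinate system, orientation or chirality, run the same deterministic algorithm in Look–Compute–Move cycles (snapshot of the whole configuration with weak multiplicity detection; decision; instantaneous move to an adjacent node or stay), fully asynchronously (finite but unbounded adversarial delays; every non-crashed robot activated infinitely often). At most one robot may crash at an adversarial time (stops forever, stays visible, indistinguishable). Gatherable despite at most one crash fault: some such algorithm guarantees in every execution with at most one crash that after finite time all non-crashed robots are on one node and remain there. Minimum enclosing square: smallest square subgrid with the same geometric center as the grid containing all occupied nodes; its corners are its four corner nodes. *)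

(* Defs.v *)
From mathcomp Require Import all_boot all_order all_fingroup.
Set Implicit Arguments. Unset Strict Implicit. Unset Printing Implicit Defensive.

Definition node (n : nat) : finType := ('I_n * 'I_n)%type.

Definition gdist n (u v : node n) : nat :=
  ((u.1 - v.1) + (v.1 - u.1) + ((u.2 - v.2) + (v.2 - u.2)))%N.
Definition adj n (u v : node n) : bool := gdist u v == 1.

(* Graph automorphisms of the grid: the possible local frames of a robot
   (no shared coordinate system, orientation or chirality; the grid is
   anonymous). *)
Definition grid_aut n (s : {perm node n}) : Prop :=
  forall u v, adj (s u) (s v) = adj u v.

(* A configuration f : V(G) -> {0,1,2} (0 empty, 1 singleton, 2 multiplicity),
   i.e. what a snapshot with weak multiplicity detection returns. *)
Definition config n := node n -> nat.

Definition cfg n k (pos : 'I_k -> node n) : config n :=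
  fun v => minn #|[pred r | pos r == v]| 2.

(* A deterministic algorithm: given the snapshot (expressed in the robot's
   local frame) and the robot's own node (in that frame), returns the
   destination node (in that frame). It must be the current node or an
   adjacent one. *)
Definition algorithm n := config n -> node n -> node n.
Definition valid_alg n (A : algorithm n) : Prop :=
  forall f u, A f u = u \/ adj u (A f u).

(* State: positions of the k robots, and for each robot the destination it
   has computed in its current Look-Compute phase (None = no pending move). *)
Definition state n k := (('I_k -> node n) * ('I_k -> option (node n)))%type.

(* One atomic event of robot r whose local frame is s (chosen adversarially):
   - if r has no pending move, it performs Look+Compute: it sees the snapshot
     through its frame s and computes its destination;
   - otherwise it performs its (instantaneous) Move to the computed node. *)
Definition step n k (A : algorithm n) (st : state n k)
    (e : 'I_k * {perm node n}) : state n k :=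
  let: (pos, pend) := st in
  let: (r, s) := e in
  match pend r with
  | None =>
      let f := cfg pos in
      let view : config n := fun u => f (s u) in
      let d := s (A view ((s^-1)%g (pos r))) in
      (pos, fun r' => if r' == r then Some d else pend r')
  | Some d =>
      (fun r' => if r' == r then d else pos r',
       fun r' => if r' == r then None else pend r')
  end.

Fixpoint exec n k (A : algorithm n) (pos0 : 'I_k -> node n)
    (sched : nat -> 'I_k * {perm node n}) (t : nat) : state n k :=
  match t with
  | 0 => (pos0, fun _ => None)
  | t'.+1 => step A (exec A pos0 sched t') (sched t')
  end.

(* A robot is non-crashed iff it is activated infinitely often; a crashed
   robot stops (finitely many activations), stays where it is and remains
   visible. *)
Definition non_crashed k (P : Type) (sched : nat -> 'I_k * P) (r : 'I_k) : Prop :=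
  forall N, exists t, N <= t /\ (sched t).1 = r.

Definition admissible n k (sched : nat -> 'I_k * {perm node n}) : Prop :=
  (forall t, grid_aut (sched t).2) /\
  (forall r1 r2, ~ non_crashed sched r1 -> ~ non_crashed sched r2 -> r1 = r2).

Definition gatherable_1crash n k (pos0 : 'I_k -> node n) : Prop :=
  exists A : algorithm n, valid_alg A /\
    forall sched, admissible sched ->
      exists T (v : node n), forall t, T <= t ->
        forall r, non_crashed sched r -> (exec A pos0 sched t).1 r = v.

(* Minimum enclosing square (concentric with the grid): for n even its
   node-index range is [m, n-1-m] where m is the minimal distance of an
   occupied node to the border of the grid. *)
Definition border_dist n (u : node n) : nat :=
  minn (minn u.1 u.2) (minn (n.-1 - u.1) (n.-1 - u.2)).
Definition mes_margin n k (pos : 'I_k -> node n) : nat :=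
  \big[minn/n]_(r < k) border_dist (pos r).
Definition mes_corners n k (pos : 'I_k -> node n) : seq (nat * nat) :=
  let m := mes_margin pos in
  [:: (m, m); (m, n.-1 - m); (n.-1 - m, m); (n.-1 - m, n.-1 - m)].
Definition occupied_nat n k (pos : 'I_k -> node n) (c : nat * nat) : bool :=
  [exists r, (val (pos r).1 == c.1) && (val (pos r).2 == c.2)].
Definition n_occupied_corners n k (pos : 'I_k -> node n) : nat :=
  count (occupied_nat pos) (mes_corners pos).

(* Main.v *)
Require Import Defs.
From mathcomp Require Import all_boot all_order all_fingroup.
From mathcomp Require Import zify.
From Stdlib Require Import Classical_Prop.
Set Implicit Arguments. Unset Strict Implicit. Unset Printing Implicit Defensive.

(** Let b be the middle one of the three occupied corners of the square, and call
    the other two its flanks.  The robots at b stay; every other robot walks to b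
    by decreasing the larger of its two coordinate distances to b, except that a
    robot on a flank waits as long as the other flank is occupied together with
    an interior node of the side that joins the other flank to the empty corner.
    No robot ever enters a flank, the empty corner or a far side, so the
    enclosing square does not change and b can be recognized in every reachable
    configuration: if exactly one flank is still occupied, then either b is a
    multiplicity, or the side from b to the empty flank is occupied while the far
    side of the occupied flank is not.  All moves, including those computed from
    outdated snapshots, therefore head for the same b, and positions are
    eventually constant.  Then a waiting flank robot is blocked by a crashed robot
    on the far side of the other flank, and the robot on that other flank, being
    alive, is blocked by a second crashed robot: contradiction. *)

(** * Grid distances and the classification of grid automorphisms *)

Section Grid.

Variable n : nat.
Implicit Types (u v w a b c : node n) (s : {perm node n}) (f : config n).

(** The Chebyshev distance. *)
Definition lmax u v : nat :=
  maxn ((u.1 - v.1) + (v.1 - u.1)) ((u.2 - v.2) + (v.2 - u.2)).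

(** Being on a diagonal of the grid, that is, being a corner of the concentric square through
    [u]. *)
Definition corner u : bool := minn u.1 (n.-1 - u.1) == minn u.2 (n.-1 - u.2).

Lemma ex_node (x y : nat) : x < n -> y < n ->
  exists u : node n, u.1 = x :> nat /\ u.2 = y :> nat.
Proof. by move=> hx hy; exists (Ordinal hx, Ordinal hy). Qed.

Lemma node_eqP u v : u.1 = v.1 :> nat -> u.2 = v.2 :> nat -> u = v.
Proof. by case: u v => [? ?] [? ?] /= /val_inj -> /val_inj ->. Qed.

Lemma gdist_triangle u v w : gdist u w <= gdist u v + gdist v w.
Proof. rewrite /gdist; lia. Qed.

Lemma gdist0 u v : gdist u v = 0 -> u = v.
Proof. by rewrite /gdist => h; apply: node_eqP; lia. Qed.

Lemma gdist_closer u v d : gdist u v = d.+1 ->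
  exists w, adj u w /\ gdist w v = d.
Proof.
have [hu1 hu2 hv1 hv2] := And4 (ltn_ord u.1) (ltn_ord u.2) (ltn_ord v.1) (ltn_ord v.2).
move=> h; case: (ltngtP u.1 v.1) => h1.
- have [|//|w [w1 w2]] := @ex_node u.1.+1 u.2; first by lia.
  by exists w; move: h; rewrite /adj /gdist w1 w2; lia.
- have [|//|w [w1 w2]] := @ex_node u.1.-1 u.2; first by lia.
  by exists w; move: h; rewrite /adj /gdist w1 w2; lia.
case: (ltngtP u.2 v.2) => h2.
- have [//||w [w1 w2]] := @ex_node u.1 u.2.+1; first by lia.
  by exists w; move: h; rewrite /adj /gdist w1 w2; lia.
- have [//||w [w1 w2]] := @ex_node u.1 u.2.-1; first by lia.
  by exists w; move: h; rewrite /adj /gdist w1 w2; lia.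
by move: h; rewrite /gdist; lia.
Qed.

Lemma grid_autV s : grid_aut s -> grid_aut (s^-1)%g.
Proof. by move=> hs u v; rewrite -hs !permKV. Qed.

(** Automorphisms are only known to preserve adjacency, so the bound is carried along a shortest
    path supplied by [gdist_closer]; equality then follows by applying it to the inverse. *)
Lemma aut_gdist_le s u v : grid_aut s -> gdist (s u) (s v) <= gdist u v.
Proof.
move=> hs; move e: (gdist u v) => d; elim: d u e => [|d IH] u e.
  by rewrite (gdist0 e) /gdist; lia.
have [w [uw wv]] := gdist_closer e.
apply: leq_trans (gdist_triangle _ (s w) _) _.
by have := IH _ wv; move: uw; rewrite -hs /adj => /eqP ->; lia.
Qed.

Lemma aut_gdist s u v : grid_aut s -> gdist (s u) (s v) = gdist u v.
Proof.
move=> hs; apply/eqP; rewrite eqn_leq aut_gdist_le //=.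
by have := aut_gdist_le (s u) (s v) (grid_autV hs); rewrite !permK.
Qed.

Definition flip (r : bool) (x : nat) : nat := if r then n.-1 - x else x.

Lemma antipodal_coord u v : gdist u v = (n.-1).*2 ->
  (u.1 = 0 :> nat \/ u.1 = n.-1 :> nat) /\ (u.2 = 0 :> nat \/ u.2 = n.-1 :> nat).
Proof.
have [h1 h2 h3 h4] := And4 (ltn_ord u.1) (ltn_ord u.2) (ltn_ord v.1) (ltn_ord v.2).
by rewrite /gdist; lia.
Qed.

(* A pair of nodes at distance 2(n-1) is a pair of opposite corners, and a node
   is determined by its distances to two adjacent corners. *)
Lemma grid_aut_dihedral s : grid_aut s ->
  exists sw r1 r2 : bool, forall u,
    (s u).1 = flip r1 (if sw then u.2 else u.1) :> nat /\
    (s u).2 = flip r2 (if sw then u.1 else u.2) :> nat.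
Proof.
move=> hs; case: (posnP n) => [n0|n_gt0].
  by exists false, false, false => u; have := ltn_ord u.1; lia.
have hN : n.-1 < n by lia.
have [k00 [a1 a2]] := ex_node n_gt0 n_gt0.
have [k11 [b1 b2]] := ex_node hN hN.
have [k01 [c1 c2]] := ex_node n_gt0 hN.
have [k10 [d1 d2]] := ex_node hN n_gt0.
have e1 : gdist (s k00) (s k11) = (n.-1).*2.
  by rewrite aut_gdist // /gdist a1 a2 b1 b2; lia.
have e2 : gdist (s k01) (s k10) = (n.-1).*2.
  by rewrite aut_gdist // /gdist c1 c2 d1 d2; lia.
have e3 : gdist (s k00) (s k01) = n.-1.
  by rewrite aut_gdist // /gdist a1 a2 c1 c2; lia.
have F u : gdist (s u) (s k00) = u.1 + u.2.
  by rewrite aut_gdist // /gdist a1 a2; lia.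
have G u : gdist (s u) (s k01) = u.1 + (n.-1 - u.2).
  by rewrite aut_gdist // /gdist c1 c2; have := ltn_ord u.2; lia.
have {e1}[P1 P2] := antipodal_coord e1; have {e2}[Q1 Q2] := antipodal_coord e2.
(* Stated over plain naturals: once the images of the two reference corners are fixed, each
   placement at distance [n.-1] determines one of the eight symmetries by linear arithmetic. *)
suff [sw [r1 [r2 H]]] : exists sw r1 r2 : bool, forall x y X Y : nat,
    x < n -> y < n -> X < n -> Y < n ->
    (X - (s k00).1) + ((s k00).1 - X) + ((Y - (s k00).2) + ((s k00).2 - Y)) = x + y ->
    (X - (s k01).1) + ((s k01).1 - X) + ((Y - (s k01).2) + ((s k01).2 - Y))
      = x + (n.-1 - y) ->
    X = flip r1 (if sw then y else x) /\ Y = flip r2 (if sw then x else y).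
  exists sw, r1, r2 => u.
  by have := H u.1 u.2 (s u).1 (s u).2 (ltn_ord _) (ltn_ord _) (ltn_ord _)
    (ltn_ord _) (F u) (G u); case: (sw).
move: e3; rewrite /gdist /flip; clear -P1 P2 Q1 Q2 n_gt0.
case: P1 P2 Q1 Q2 => -> [] -> [] -> [] ->; rewrite ?subn0 ?sub0n ?subnn => e;
  try (by exfalso; lia);
  solve [by exists false, false, false => x y X Y; lia
       | by exists false, false, true => x y X Y; lia
       | by exists false, true, false => x y X Y; lia
       | by exists false, true, true => x y X Y; lia
       | by exists true, false, false => x y X Y; lia
       | by exists true, false, true => x y X Y; lia
       | by exists true, true, false => x y X Y; lia
       | by exists true, true, true => x y X Y; lia].
Qed.

Lemma flip_dist r x y : x < n -> y < n ->
  (flip r x - flip r y) + (flip r y - flip r x) = (x - y) + (y - x).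
Proof. by case: r => //=; lia. Qed.

Lemma flip_depth r x : x < n ->
  minn (flip r x) (n.-1 - flip r x) = minn x (n.-1 - x).
Proof. by case: r => //= xn; rewrite subKn 1?minnC //; lia. Qed.

Lemma aut_lmax s u v : grid_aut s -> lmax (s u) (s v) = lmax u v.
Proof.
move/grid_aut_dihedral=> [sw [r1 [r2 E]]]; have [E1 E2] := E u; have [E3 E4] := E v.
by rewrite /lmax E1 E2 E3 E4; case: sw {E E1 E2 E3 E4};
  rewrite !flip_dist ?ltn_ord // maxnC.
Qed.

Lemma aut_border_dist s u : grid_aut s -> border_dist (s u) = border_dist u.
Proof.
move/grid_aut_dihedral=> [sw [r1 [r2 E]]]; have [E1 E2] := E u.
by rewrite /border_dist !(minnACA _ (_ (s u).2)) !(minnACA _ u.2) E1 E2;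
  case: sw {E E1 E2}; rewrite !flip_depth ?ltn_ord // minnC.
Qed.

Lemma aut_corner s u : grid_aut s -> corner (s u) = corner u.
Proof.
move/grid_aut_dihedral=> [sw [r1 [r2 E]]]; have [E1 E2] := E u.
by rewrite /corner E1 E2; case: sw {E E1 E2}; rewrite !flip_depth ?ltn_ord // eq_sym.
Qed.

End Grid.

(** * The algorithm, its equivariance and the uniqueness of its target *)

Section Algorithm.

Variable n : nat.
Implicit Types (u v w a b c : node n) (s : {perm node n}) (f : config n).

(** Side length, in edges, of the concentric square through [b]. *)
Definition ell b : nat := n.-1 - (border_dist b).*2.

(** Phrased, like the predicates below, through [border_dist], [lmax] and [gdist] only, so that
    invariance under automorphisms is immediate. *)
Definition flank b u : bool :=
  [&& border_dist b <= border_dist u, lmax u b == ell b & gdist u b == ell b].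

(* Interior of the side of the square that contains the flank [a] but not [b]. *)
Definition far_side b a u : bool :=
  [&& border_dist b <= border_dist u, lmax u b == ell b,
      ell b < gdist u b & gdist u a < ell b].

(* Interior of the side of the square that joins [b] to the flank [a]. *)
Definition near_side b a u : bool :=
  [&& border_dist b <= border_dist u, gdist u b == lmax u b,
      0 < gdist u a & gdist u a < ell b].

(** The strict bound [(ell b).*2] forbids just the corner opposite [b] within the square. The last
    clause tells [b] from its flank [a] when [a] is the only occupied flank and [b] is not a
    multiplicity. *)
Definition target f b : bool :=
  [&& corner b, 0 < f b,
      [forall u, (0 < f u) ==>
         (border_dist b <= border_dist u) && (gdist u b < (ell b).*2)],
      [forall a, flank b a ==> (f a <= 1)] &
      [forall a, forall c,
         [&& flank b a, flank b c, gdist a c == (ell b).*2, 0 < f a, f c == 0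
           & f b <= 1] ==>
         [exists u, near_side b c u && (0 < f u)] &&
         [forall u, far_side b a u ==> (f u == 0)]]].

Definition blocked f b u : bool :=
  flank b u &&
  [exists c, exists w, [&& flank b c, gdist u c == (ell b).*2, 0 < f c,
                           far_side b c w & 0 < f w]].

(* [v] is obtained from [u] by decreasing the larger coordinate distance to
   [b]; the two coordinate distances are equal iff [gdist] is twice [lmax]. *)
Definition toward b u v : bool :=
  [&& adj u v, gdist v b < gdist u b &
      (lmax v b < lmax u b) || (gdist u b == (lmax u b).*2)].

(** The inner [pick] depends on the local frame; this is harmless, since only [toward] is ever used
    of the chosen node. *)
Definition gather : algorithm n := fun f u =>
  if [pick b | target f b] is Some b then
    if (u == b) || blocked f b u then u else odflt u [pick v | toward b u v]
  else u.

Lemma gather_valid : valid_alg gather.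
Proof.
move=> f u; rewrite /gather; case: pickP => [b _|_]; last by left.
case: ifP => _; first by left.
by case: pickP => [v /and3P[]|_] /=; [right | left].
Qed.

Lemma toward_ex b u : u != b -> exists v, toward b u v.
Proof.
move=> ub; have [h1 h2 h3 h4] := And4 (ltn_ord u.1) (ltn_ord u.2) (ltn_ord b.1) (ltn_ord b.2).
have {ub} ub : u.1 <> b.1 :> nat \/ u.2 <> b.2 :> nat.
  by have [e1|] := eqVneq (u.1 : nat) b.1; [right=> e2; move: ub; rewrite (node_eqP e1 e2) eqxx | left; lia].
rewrite /toward /adj /gdist /lmax.
have [le|lt] := leqP ((u.2 - b.2) + (b.2 - u.2)) ((u.1 - b.1) + (b.1 - u.1)).
  case: (ltngtP u.1 b.1) => hc; last by lia.
    have [||w [w1 w2]] := @ex_node n u.1.+1 u.2; [lia | lia | exists w; rewrite w1 w2; lia].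
  have [||w [w1 w2]] := @ex_node n u.1.-1 u.2; [lia | lia | exists w; rewrite w1 w2; lia].
case: (ltngtP u.2 b.2) => hc; last by lia.
  have [||w [w1 w2]] := @ex_node n u.1 u.2.+1; [lia | lia | exists w; rewrite w1 w2; lia].
have [||w [w1 w2]] := @ex_node n u.1 u.2.-1; [lia | lia | exists w; rewrite w1 w2; lia].
Qed.

(** * Equivariance *)

Lemma forall_perm (T : finType) (s : {perm T}) (P : pred T) :
  [forall x, P x] = [forall x, P (s x)].
Proof.
apply/forallP/forallP => h x //.
by have := h ((s^-1)%g x); rewrite permKV.
Qed.

Lemma exists_perm (T : finType) (s : {perm T}) (P : pred T) :
  [exists x, P x] = [exists x, P (s x)].
Proof.
apply/existsP/existsP => -[x Px]; last by exists (s x).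
by exists ((s^-1)%g x); rewrite permKV.
Qed.

Section Aut.
Variable s : {perm node n}.
Hypothesis hs : grid_aut s.

Lemma aut_ell b : ell (s b) = ell b.
Proof. by rewrite /ell aut_border_dist. Qed.

Lemma aut_flank b u : flank (s b) (s u) = flank b u.
Proof. by rewrite /flank aut_ell !aut_border_dist // aut_lmax // aut_gdist. Qed.

Lemma aut_far_side b a u : far_side (s b) (s a) (s u) = far_side b a u.
Proof. by rewrite /far_side aut_ell !aut_border_dist // aut_lmax // !aut_gdist. Qed.

Lemma aut_near_side b a u : near_side (s b) (s a) (s u) = near_side b a u.
Proof. by rewrite /near_side aut_ell !aut_border_dist // aut_lmax // !aut_gdist. Qed.

Lemma aut_toward b u v : toward (s b) (s u) (s v) = toward b u v.
Proof. by rewrite /toward hs !aut_gdist // !aut_lmax. Qed.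

Lemma aut_blocked f b u : blocked (fun x => f (s x)) b u = blocked f (s b) (s u).
Proof.
rewrite /blocked aut_flank; congr (_ && _); rewrite [RHS](exists_perm s).
apply: eq_existsb => c; rewrite [RHS](exists_perm s); apply: eq_existsb => w.
by rewrite aut_flank aut_ell aut_gdist // aut_far_side.
Qed.

Lemma aut_target f b : target (fun x => f (s x)) b = target f (s b).
Proof.
rewrite /target aut_corner // aut_ell; congr [&& _, _, _, _ & _].
- rewrite [RHS](forall_perm s); apply: eq_forallb => u.
  by rewrite !aut_border_dist // aut_gdist.
- by rewrite [RHS](forall_perm s); apply: eq_forallb => u; rewrite aut_flank.
rewrite [RHS](forall_perm s); apply: eq_forallb => a.
rewrite [RHS](forall_perm s); apply: eq_forallb => c.
rewrite !aut_flank aut_gdist //; congr (_ ==> (_ && _)).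
  by rewrite [RHS](exists_perm s); apply: eq_existsb => u; rewrite aut_near_side.
by rewrite [RHS](forall_perm s); apply: eq_forallb => u; rewrite aut_far_side.
Qed.

End Aut.

(** * Coordinates relative to a corner *)

Definition dx b u : nat := (u.1 - b.1) + (b.1 - u.1).
Definition dy b u : nat := (u.2 - b.2) + (b.2 - u.2).

Lemma corner_coord b : corner b ->
  let m := border_dist b in
  [/\ b.1 = m :> nat \/ b.1 = n.-1 - m :> nat, b.2 = m :> nat \/ b.2 = n.-1 - m :> nat
    & m.*2 <= n.-1].
Proof.
have [h1 h2] := (ltn_ord b.1, ltn_ord b.2).
by rewrite /corner /border_dist => h; split; lia.
Qed.

Lemma depth_coord m u : m <= border_dist u ->
  [/\ m <= u.1, u.1 <= n.-1 - m, m <= u.2 & u.2 <= n.-1 - m].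
Proof.
have [h1 h2] := (ltn_ord u.1, ltn_ord u.2).
by rewrite /border_dist => h; split; lia.
Qed.

Lemma dxy_le b u : corner b -> border_dist b <= border_dist u ->
  dx b u <= ell b /\ dy b u <= ell b.
Proof.
move=> /corner_coord[h1 h2 h3] /depth_coord[h4 h5 h6 h7].
rewrite /dx /dy /ell; move: (border_dist b) h1 h2 h3 h4 h5 h6 h7 => m; lia.
Qed.

(** Along each axis the whole square lies on one side of its corner [b], so the distances to [b]
    serve as coordinates with origin [b]. *)
Lemma dx_dist b u w : corner b -> border_dist b <= border_dist u ->
  border_dist b <= border_dist w ->
  (u.1 - w.1) + (w.1 - u.1) = (dx b u - dx b w) + (dx b w - dx b u).
Proof.
move=> /corner_coord[h1 _ h3] /depth_coord[h4 h5 _ _] /depth_coord[h6 h7 _ _].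
rewrite /dx; move: (border_dist b) h1 h3 h4 h5 h6 h7 => m; lia.
Qed.

Lemma dy_dist b u w : corner b -> border_dist b <= border_dist u ->
  border_dist b <= border_dist w ->
  (u.2 - w.2) + (w.2 - u.2) = (dy b u - dy b w) + (dy b w - dy b u).
Proof.
move=> /corner_coord[_ h1 h3] /depth_coord[_ _ h4 h5] /depth_coord[_ _ h6 h7].
rewrite /dy; move: (border_dist b) h1 h3 h4 h5 h6 h7 => m; lia.
Qed.

Lemma gdist_rel b u w : corner b -> border_dist b <= border_dist u ->
  border_dist b <= border_dist w ->
  gdist u w = (dx b u - dx b w) + (dx b w - dx b u)
              + ((dy b u - dy b w) + (dy b w - dy b u)).
Proof. by move=> cb hu hw; rewrite /gdist -dx_dist // -dy_dist. Qed.

Lemma lmax_rel b u w : corner b -> border_dist b <= border_dist u ->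
  border_dist b <= border_dist w ->
  lmax u w = maxn ((dx b u - dx b w) + (dx b w - dx b u))
                  ((dy b u - dy b w) + (dy b w - dy b u)).
Proof. by move=> cb hu hw; rewrite /lmax -dx_dist // -dy_dist. Qed.

Lemma gdist_target b u : gdist u b = dx b u + dy b u.
Proof. by []. Qed.

Lemma lmax_target b u : lmax u b = maxn (dx b u) (dy b u).
Proof. by []. Qed.

Lemma dxx b : dx b b = 0. Proof. by rewrite /dx subnn. Qed.
Lemma dyy b : dy b b = 0. Proof. by rewrite /dy subnn. Qed.

Lemma rel_inj b u w : corner b -> border_dist b <= border_dist u ->
  border_dist b <= border_dist w -> dx b u = dx b w -> dy b u = dy b w -> u = w.
Proof.
by move=> cb hu hw e1 e2; apply: gdist0; rewrite (gdist_rel cb) // e1 e2 !subnn.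
Qed.

Lemma corner_rel b u : corner b -> corner u -> border_dist u = border_dist b ->
  (dx b u = 0 \/ dx b u = ell b) /\ (dy b u = 0 \/ dy b u = ell b).
Proof.
move=> /corner_coord[h1 h2 h3] /corner_coord[h4 h5 _] e; rewrite {}e in h4 h5.
rewrite /dx /dy /ell; move: (border_dist b) h1 h2 h3 h4 h5 => m h1 h2 h3 h4 h5.
by split; [clear h2 h5 | clear h1 h4]; lia.
Qed.

(* The flanks of a corner are its mirror images in the two axes of the grid. *)
Definition mirror1 b : node n := (rev_ord b.1, b.2).
Definition mirror2 b : node n := (b.1, rev_ord b.2).

Lemma rev_ord_flip (i : 'I_n) : rev_ord i = flip n true i :> nat.
Proof. by rewrite /flip /=; lia. Qed.

Lemma mirror1_rel b : corner b -> [/\ border_dist (mirror1 b) = border_dist b,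
  dx b (mirror1 b) = ell b & dy b (mirror1 b) = 0].
Proof.
move=> cb; have [h1 _ h3] := corner_coord cb; split; last by rewrite /dy /= subnn.
- rewrite /border_dist !(minnACA _ (_ (mirror1 b).2)) rev_ord_flip.
  by rewrite flip_depth.
- rewrite /dx rev_ord_flip /ell /flip; move: (border_dist b) h1 h3 => m; lia.
Qed.

Lemma mirror2_rel b : corner b -> [/\ border_dist (mirror2 b) = border_dist b,
  dx b (mirror2 b) = 0 & dy b (mirror2 b) = ell b].
Proof.
move=> cb; have [_ h1 h3] := corner_coord cb; split; first 1 last.
- by rewrite /dx /= subnn.
- rewrite /dy rev_ord_flip /ell /flip; move: (border_dist b) h1 h3 => m; lia.
- rewrite /border_dist !(minnACA _ (_ (mirror2 b).2)) rev_ord_flip.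
  by rewrite flip_depth // minnACA.
Qed.

(** Here evenness enters: [n.-1] is odd, so no concentric square degenerates to a point. *)
Lemma ell_gt0 b : ~~ odd n -> 0 < ell b.
Proof.
rewrite /ell /border_dist; have := ltn_ord b.1; have := ltn_ord b.2.
lia.
Qed.

Lemma targetP f b : reflect
  [/\ corner b, 0 < f b,
      forall u, 0 < f u -> border_dist b <= border_dist u /\ gdist u b < (ell b).*2,
      forall a, flank b a -> f a <= 1 &
      forall a c, flank b a -> flank b c -> gdist a c = (ell b).*2 -> 0 < f a ->
        f c = 0 -> f b <= 1 ->
        (exists2 u, near_side b c u & 0 < f u) /\
        (forall u, far_side b a u -> f u = 0)]
  (target f b).
Proof.
apply: (iffP and5P) => -[h1 h2 h3 h4 h5]; split=> //.
- by move=> u; have /implyP := forallP h3 u => h /h /andP.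
- by move=> a; have /implyP := forallP h4 a.
- move=> a c ha hc e fa fc fb; have := forallP (forallP h5 a) c.
  rewrite ha hc e fa fc fb !eqxx /= => /andP[/existsP[u /andP[hu fu]] h].
  split; first by exists u.
  by move=> w hw; have := forallP h w; rewrite hw => /eqP.
- by apply/forallP => u; apply/implyP => /h3[-> ->].
- by apply/forallP => a; apply/implyP => /h4.
apply/forallP => a; apply/forallP => c; apply/implyP.
move=> /and5P[ha hc /eqP e fa /andP[/eqP fc fb]].
have [[u hu fu] h] := h5 a c ha hc e fa fc fb; apply/andP; split.
  by apply/existsP; exists u; rewrite hu.
by apply/forallP => w; apply/implyP => /h ->.
Qed.

(* A second target would be a flank [b'] of the first one; the side from [b']
   away from [b] would then have to be both occupied and empty. *)
Lemma target_unique f b b' : ~~ odd n -> target f b -> target f b' -> b' = b.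
Proof.
move=> nodd /targetP[cb fb sq fl amb] /targetP[cb' fb' sq' fl' amb'].
have l0 := ell_gt0 b nodd.
have [m1 d1] := sq _ fb'; have [m2 d2] := sq' _ fb.
(* Each candidate lies in the square of the other, so the squares coincide. *)
have em : border_dist b' = border_dist b by lia.
have el : ell b' = ell b by rewrite /ell em.
have mb := leqnn (border_dist b).
(* Here [c] is the other flank of [b], opposite [b'], and [d] is the corner opposite [b]; the
   disjunction lists the two axes on which [b'] may lie. *)
suff key c d : border_dist c = border_dist b -> border_dist d = border_dist b ->
    (dx b b' = ell b /\ dy b b' = 0 /\ dx b c = 0 /\ dy b c = ell b /\
       dx b d = ell b /\ dy b d = ell b) \/
    (dy b b' = ell b /\ dx b b' = 0 /\ dy b c = 0 /\ dx b c = ell b /\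
       dy b d = ell b /\ dx b d = ell b) -> False.
  have [M1 M2 M3] := mirror1_rel cb; have [N1 N2 N3] := mirror2_rel cb.
  have [cx cy] := corner_rel cb cb' em.
  have [p1 p2 p3] := mirror1_rel cb'; have [q1 q2 q3] := mirror2_rel cb'.
  have E1 : dx b (mirror2 b') = dx b b' by [].
  have E2 : dy b (mirror1 b') = dy b b' by [].
  have E3 : (dx b (mirror1 b') - dx b b') + (dx b b' - dx b (mirror1 b')) = ell b.
    by rewrite -dx_dist ?p1 ?em // -el -p2 /dx.
  have E4 : (dy b (mirror2 b') - dy b b') + (dy b b' - dy b (mirror2 b')) = ell b.
    by rewrite -dy_dist ?q1 ?em // -el -q3 /dy.
  move: d1; rewrite gdist_target => d1.
  case: cx cy => [x0|xl] [y0|yl].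
  - by apply: (rel_inj cb) => //; rewrite ?dxx ?dyy.
  - by exfalso; apply: (key (mirror1 b) (mirror1 b')); rewrite ?p1 ?em //; lia.
  - by exfalso; apply: (key (mirror2 b) (mirror2 b')); rewrite ?q1 ?em //; lia.
  - by lia.
move=> ec ed H.
have hc : border_dist b <= border_dist c by lia.
have hd : border_dist b <= border_dist d by lia.
have fc : f c = 0.
  apply/eqP; rewrite -leqn0 leqNgt; apply/negP => /sq'[_].
  by rewrite el (gdist_rel cb) //; lia.
have fd : f d = 0.
  apply/eqP; rewrite -leqn0 leqNgt; apply/negP => /sq[_].
  by rewrite gdist_target; lia.
have fbb' : flank b b' by rewrite /flank m1 gdist_target lmax_target; lia.
have fbc : flank b c by rewrite /flank hc gdist_target lmax_target; lia.
have fb'b : flank b' b.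
  by rewrite /flank em mb el (gdist_rel cb) // (lmax_rel cb) // dxx dyy; lia.
have fb'd : flank b' d.
  by rewrite /flank em hd el (gdist_rel cb) // (lmax_rel cb) //; lia.
have gbc : gdist b' c = (ell b).*2 by rewrite (gdist_rel cb) //; lia.
have gbd : gdist b d = (ell b').*2 by rewrite el (gdist_rel cb) // dxx dyy; lia.
(* Each candidate is a flank of the other, so neither is a multiplicity and both recognition clauses
   apply. *)
have [_ E] := amb _ _ fbb' fbc gbc fb' fc (fl' _ fb'b).
have [[u nu fu] _] := amb' _ _ fb'b fb'd gbd fb fd (fl _ fbb').
suff /E : far_side b b' u by lia.
have [hu _] := sq _ fu; have [xu yu] := dxy_le cb hu; move: nu.
rewrite /near_side /far_side el hu em hu !(gdist_rel cb _ m1) // (lmax_rel cb _ m1) //.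
rewrite (gdist_rel cb _ hd) // gdist_target lmax_target.
clear -H xu yu; move: (dx b u) (dy b u) H xu yu => x y H xu yu.
by case: H => -[-> [-> [_ [_ [-> ->]]]]]; lia.
Qed.

(** A frame-free specification: by uniqueness, the target found in the local frame is the preimage
    of [b]. *)
Lemma gather_move s f b u : ~~ odd n -> grid_aut s -> target f b ->
  let d := s (gather (fun x => f (s x)) ((s^-1)%g u)) in
  if (u == b) || blocked f b u then d = u else toward b u d.
Proof.
move=> nodd hs tb /=.
have tb' : target (fun x => f (s x)) ((s^-1)%g b) by rewrite aut_target // permKV.
rewrite /gather; case: pickP => [b'' tb''|/(_ ((s^-1)%g b))]; last by rewrite tb'.
have -> : b'' = (s^-1)%g b by apply: target_unique tb''.
rewrite (inj_eq perm_inj) aut_blocked // !permKV.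
case: (boolP ((u == b) || blocked f b u)) => [_|]; first by rewrite permKV.
rewrite negb_or => /andP[ub _].
case: pickP => [v|h] /=; first by rewrite -(aut_toward hs ((s^-1)%g b)) !permKV.
have [v] := toward_ex ub.
by rewrite -{1}(permKV s v) -{1}(permKV s b) -{1}(permKV s u) aut_toward // h.
Qed.

End Algorithm.

(** * Reading occupancy and multiplicity off a snapshot *)

Lemma cfg_gt0P n k (pos : 'I_k -> node n) v :
  reflect (exists r, pos r = v) (0 < cfg pos v).
Proof.
rewrite /cfg leq_min andbT; apply: (iffP card_gt0P) => -[r].
  by rewrite inE => /eqP; exists r.
by move=> h; exists r; rewrite inE h.
Qed.

Lemma cfg_le1 n k (pos : 'I_k -> node n) v r0 :
  (forall r, pos r = v -> r = r0) -> cfg pos v <= 1.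
Proof.
move=> h; rewrite /cfg geq_min; apply/orP; left.
rewrite -(card1 r0); apply: subset_leq_card; apply/subsetP => r.
by rewrite !inE => /eqP/h->.
Qed.

Lemma cfg_gt1 n k (pos : 'I_k -> node n) v r1 r2 :
  r1 <> r2 -> pos r1 = v -> pos r2 = v -> 1 < cfg pos v.
Proof.
move=> /eqP ne e1 e2; rewrite /cfg leq_min andbT.
have <- : #|pred2 r1 r2| = 2 by rewrite card2 ne.
apply: subset_leq_card; apply/subsetP => r.
by rewrite !inE => /orP[] /eqP ->; apply/eqP.
Qed.

(** * Sides of the square and the effect of one step *)

Section SquareGeometry.

Variables (n : nat) (b : node n).
Hypothesis cb : corner b.
Implicit Types (u v w : node n) (i j : bool).

Definition in_square u : bool := border_dist b <= border_dist u.

(** A boolean names a flank together with its axis, so both flanks are handled by one argument;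
    [along] and [off] are the coordinates parallel and perpendicular to the side from [b] to that
    flank. *)
Definition side i : node n := if i then mirror1 b else mirror2 b.
Definition along i u : nat := if i then dx b u else dy b u.
Definition off i u : nat := if i then dy b u else dx b u.

Lemma alongN i u : along (~~ i) u = off i u. Proof. by case: i. Qed.
Lemma offN i u : off (~~ i) u = along i u. Proof. by case: i. Qed.

Lemma side_rel i : [/\ in_square (side i), along i (side i) = ell b & off i (side i) = 0].
Proof.
rewrite /in_square; case: i => /=.
  by have [-> -> ->] := mirror1_rel cb.
by have [-> -> ->] := mirror2_rel cb.
Qed.

Lemma along_le i u : in_square u -> along i u <= ell b /\ off i u <= ell b.
Proof. by move/(dxy_le cb); case: i => /= -[]. Qed.

Lemma gdist_along i u : gdist u b = along i u + off i u.
Proof. by case: i; rewrite gdist_target // addnC. Qed.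

Lemma lmax_along i u : lmax u b = maxn (along i u) (off i u).
Proof. by case: i; rewrite lmax_target // maxnC. Qed.

Lemma gdist_side i u : in_square u -> gdist u (side i) = ell b - along i u + off i u.
Proof.
move=> hu; have [hs sa so] := side_rel i; have [h1 h2] := along_le i hu.
rewrite (gdist_rel cb hu hs); move: sa so h1 h2; case: i {hs} => /= -> ->; lia.
Qed.

Lemma along_inj i u w : in_square u -> in_square w ->
  along i u = along i w -> off i u = off i w -> u = w.
Proof. by move=> hu hw; case: i => /= *; apply: (rel_inj cb). Qed.

Lemma eq_side i u : in_square u -> along i u = ell b -> off i u = 0 -> u = side i.
Proof.
by move=> hu e1 e2; have [hs sa so] := side_rel i; apply: (along_inj (i := i)); lia.
Qed.

Lemma eq_target i u : along i u = 0 -> off i u = 0 -> u = b.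
Proof. by move=> e1 e2; apply: gdist0; rewrite (gdist_along i) e1 e2. Qed.

Lemma side_neq_target i : 0 < ell b -> side i <> b.
Proof.
move=> l0; have [_ sa so] := side_rel i; move=> e; move: l0; rewrite -sa e.
by case: i {sa so e} => /=; rewrite ?dxx ?dyy.
Qed.

Lemma flankP u : reflect (exists i, u = side i) (flank b u).
Proof.
apply: (iffP idP) => [/and3P[hu /eqP h1 /eqP h2]|[i ->]].
  have [e|e] : (along true u = ell b /\ off true u = 0) \/
    (along false u = ell b /\ off false u = 0).
    by move: h1 h2; rewrite (lmax_along true) (gdist_along true) /=; lia.
    by exists true; apply: eq_side => //; case: e.
  by exists false; apply: eq_side => //; case: e.
have [hs sa so] := side_rel i; apply/and3P; split=> //.
  by rewrite (lmax_along i) sa so maxn0.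
by rewrite (gdist_along i) sa so addn0.
Qed.

Lemma opposite_flank i : gdist (side i) (side (~~ i)) = (ell b).*2.
Proof.
have [hs sa so] := side_rel i; rewrite gdist_side // alongN offN sa so; lia.
Qed.

Lemma opposite_flank_inj i j : 0 < ell b ->
  gdist (side i) (side j) = (ell b).*2 -> j = ~~ i.
Proof.
move=> l0; have [_ sa so] := side_rel i.
by case: (eqVneq i j) => [<-|]; [rewrite /gdist; lia | case: i {sa so} j => [] []].
Qed.

Lemma far_sideE i u : in_square u ->
  far_side b (side i) u = [&& along i u == ell b, 0 < off i u & off i u < ell b].
Proof.
move=> hu; have [h1 h2] := along_le i hu; rewrite /far_side (hu : _ <= _) /=.
rewrite gdist_side // (lmax_along i) (gdist_along i); lia.
Qed.

Lemma near_sideE i u : in_square u ->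
  near_side b (side i) u = [&& off i u == 0, 0 < along i u & along i u < ell b].
Proof.
move=> hu; have [h1 h2] := along_le i hu; rewrite /near_side (hu : _ <= _) /=.
rewrite gdist_side // (lmax_along i) (gdist_along i); lia.
Qed.

Lemma far_side_neq i j u : far_side b (side i) u -> u <> side j.
Proof.
move=> h e; have [hs sa so] := side_rel j; move: h; rewrite e far_sideE //.
by case: (eqVneq i j) => [->|/negPf ne]; [lia|];
  have -> : i = ~~ j by [case: i j ne {hs sa so e} => [] []];
  rewrite alongN offN; lia.
Qed.

(** The two far sides share just the corner opposite [b], which their interiors omit. *)
Lemma far_side_disjoint i u : far_side b (side i) u -> ~~ far_side b (side (~~ i)) u.
Proof.
move=> h; have hu : in_square u by case/and4P: h.
by move: h; rewrite !far_sideE // alongN offN; lia.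
Qed.

Lemma adj_coord u v : adj u v ->
  (u.1 = v.1 /\ (v.2 = u.2.+1 :> nat \/ u.2 = v.2.+1 :> nat)) \/
  (u.2 = v.2 /\ (v.1 = u.1.+1 :> nat \/ u.1 = v.1.+1 :> nat)).
Proof.
rewrite /adj /gdist => /eqP h.
have [e|e] : (u.1 = v.1 :> nat /\ (v.2 = u.2.+1 :> nat \/ u.2 = v.2.+1 :> nat)) \/
  (u.2 = v.2 :> nat /\ (v.1 = u.1.+1 :> nat \/ u.1 = v.1.+1 :> nat)) by lia.
  by left; split; [apply: val_inj; case: e | case: e].
by right; split; [apply: val_inj; case: e | case: e].
Qed.

Lemma step_between m N x y z : z = m \/ z = N - m -> m.*2 <= N ->
  m <= x -> x <= N - m -> y = x.+1 \/ x = y.+1 ->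
  (x - z) + (z - x) = ((y - z) + (z - y)).+1 -> m <= y /\ m <= N - y.
Proof. by move=> [] -> h h1 h2 [] e; lia. Qed.

Lemma toward_rel u v : in_square u -> toward b u v ->
  in_square v /\
  exists i, [/\ off i v = off i u, along i u = (along i v).+1 & off i u <= along i u].
Proof.
move=> hu /and3P[/adj_coord uv lt1 lt2].
have [b1 b2 b3] := corner_coord cb; have [u1 u2 u3 u4] := depth_coord hu.
move: lt1 lt2; rewrite !(gdist_along true) !(lmax_along true) /= => lt1 lt2.
case: uv => -[e s].
  have ex : dx b v = dx b u by rewrite /dx e.
  have ey : dy b u = (dy b v).+1.
    by rewrite {}ex in lt1 lt2; clear -lt1 s; move: lt1; rewrite /dy; lia.
  split; last by exists false; split=> //=; clear -ex ey lt2; lia.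
  have [h1 h2] := step_between b2 b3 u3 u4 s ey.
  by rewrite /in_square {2}/border_dist -e !leq_min h1 h2 u1 andbT; clear -u2 b3; lia.
have ey : dy b v = dy b u by rewrite /dy e.
have ex : dx b u = (dx b v).+1.
  by rewrite {}ey in lt1 lt2; clear -lt1 s; move: lt1; rewrite /dx; lia.
split; last by exists true; split=> //=; clear -ex ey lt2; lia.
have [h1 h2] := step_between b1 b3 u1 u2 s ex.
by rewrite /in_square {2}/border_dist -e !leq_min h1 h2 u3 !andTb; clear -u4 b3; lia.
Qed.

(** After a step onto a flank or far side some coordinate would equal [ell b]. It is not the
    decreased one; being the smaller one before the step, it would place [u] at the corner opposite
    [b]. *)
Lemma toward_preserves u v : in_square u -> gdist u b < (ell b).*2 ->
  v = u \/ toward b u v ->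
  [/\ in_square v /\ gdist v b < (ell b).*2,
      forall j, v = side j -> u = side j,
      forall j, far_side b (side j) v -> far_side b (side j) u,
      forall j, off j u = 0 -> off j v = 0 &
      u = b -> v = b].
Proof.
move=> hu du [->|/(toward_rel hu)[hv [i [e1 e2 e3]]]]; first by [].
have [a1 a2] := along_le i hu; move: du; rewrite !(gdist_along i) => du.
split; first by split=> //; lia.
- move=> j ej; have [_ sa so] := side_rel j; rewrite -ej in sa so; exfalso.
  have [ij|ij] : j = i \/ j = ~~ i by case: (i) (j) => [] []; [left|right|right|left].
    by rewrite ij in sa so; lia.
  by rewrite ij alongN offN in sa so; lia.
- move=> j; rewrite !far_sideE //.
  have [->|->] : j = i \/ j = ~~ i by case: (i) (j) => [] []; [left|right|right|left].
    lia.
  by rewrite !alongN !offN; lia.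
- move=> j; have [->|->] : j = i \/ j = ~~ i by case: (i) (j) => [] []; [left|right|right|left].
    lia.
  by rewrite !offN; lia.
by move=> ub; move: e2; rewrite ub; case: (i) => /=; rewrite ?dxx ?dyy.
Qed.

End SquareGeometry.

(** * The invariant of asynchronous executions *)

Section Execution.

Variables (n k : nat) (b : node n) (rB : 'I_k) (rob : bool -> 'I_k).
Hypotheses (n_even : ~~ odd n) (cb : corner b) (rBrob : forall i, rB <> rob i).
Implicit Types (pos : 'I_k -> node n) (pend : 'I_k -> option (node n)) (r : 'I_k) (i : bool).

Let l0 : 0 < ell b := ell_gt0 b n_even.

(** A pending departure counts as leaving, because it will be executed even if the snapshot behind
    it is outdated. *)
Definition leaving pos pend i : Prop :=
  pos (rob i) <> side b i \/ (exists2 d, pend (rob i) = Some d & d <> side b i).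

(** [rB] holds the target and [rob i] is the only robot ever on flank [i]. [inv_rob] and
    [inv_leaving] yield the near-side and far-side conditions of [target]. *)
Record invariant (st : state n k) : Prop := Invariant {
  inv_square : forall r, in_square b (st.1 r) /\ gdist (st.1 r) b < (ell b).*2;
  inv_pend : forall r d, st.2 r = Some d -> d = st.1 r \/ toward b (st.1 r) d;
  inv_target : st.1 rB = b;
  inv_side : forall i r, st.1 r = side b i -> r = rob i;
  inv_rob : forall i, off b i (st.1 (rob i)) = 0;
  inv_leaving : forall i, leaving st.1 st.2 i -> st.1 (rob (~~ i)) = side b (~~ i) ->
    forall r, ~~ far_side b (side b (~~ i)) (st.1 r) }.

Lemma invariant_target st : invariant st -> target (cfg st.1) b.
Proof.
case: st => pos pend [/= sq _ tB sd rb lv]; apply/targetP; split=> //.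
- by apply/cfg_gt0P; exists rB.
- by move=> u /cfg_gt0P[r <-]; exact: sq.
- by move=> a /(flankP cb)[i ->]; apply: (@cfg_le1 _ _ _ _ (rob i)) => r; exact: sd.
move=> a c /(flankP cb)[i ->] /(flankP cb)[j ->].
move=> /(opposite_flank_inj cb l0) -> /cfg_gt0P[ri posi] fc fb.
(* The robot of the empty flank is still on its side and has not reached [b], as [b] is not a
   multiplicity; hence it witnesses the near side. *)
have nj : pos (rob (~~ i)) <> side b (~~ i).
  by move=> e; have : 0 < cfg pos (side b (~~ i)) by [apply/cfg_gt0P; exists (rob (~~ i))]; rewrite fc.
have nb : pos (rob (~~ i)) <> b.
  by move=> e; have := cfg_gt1 (@rBrob (~~ i)) tB e; lia.
split.
  exists (pos (rob (~~ i))); last by apply/cfg_gt0P; exists (rob (~~ i)).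
  have [hs _] := sq (rob (~~ i)); have [a1 a2] := along_le cb (~~ i) hs.
  have o0 := rb (~~ i); rewrite near_sideE // o0 eqxx /= lt0n; apply/andP; split.
    by apply/eqP => a0; apply: nb; apply: (eq_target (i := ~~ i)).
  rewrite ltn_neqAle a1 andbT; apply/eqP => al; apply: nj.
  exact: eq_side.
move=> u fu; apply/eqP; rewrite -leqn0 leqNgt; apply/negP => /cfg_gt0P[r er].
have := lv (~~ i) (or_introl nj); rewrite negbK -(sd _ _ posi) => /(_ posi r).
by rewrite er fu.
Qed.

(** The second conjunct serves liveness: idling away from [b] has a blocking witness. The third
    maintains [inv_leaving]. *)
Lemma look_spec st s r : invariant st -> grid_aut s ->
  let d := s (gather (fun x => cfg st.1 (s x)) ((s^-1)%g (st.1 r))) in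
  (d = st.1 r \/ toward b (st.1 r) d) /\
  (d = st.1 r -> st.1 r <> b -> exists i r', [/\ r = rob i, st.1 r = side b i,
     st.1 (rob (~~ i)) = side b (~~ i) & far_side b (side b (~~ i)) (st.1 r')]) /\
  (forall i, st.1 r = side b i -> st.1 (rob (~~ i)) = side b (~~ i) ->
     d <> st.1 r -> forall r', ~~ far_side b (side b (~~ i)) (st.1 r')).
Proof.
move=> I hs d; have := gather_move (st.1 r) n_even hs (invariant_target I).
rewrite /= -/d; case: ifP => [|/negbT].
  move=> h e; split; [by left | split=> [_ nb|i _ _ /(_ e)//]].
  case/orP: h => [/eqP//|/andP[/(flankP cb)[i ei]]].
  move=> /existsP[c /existsP[w /and5P[/(flankP cb)[j ej] /eqP dij fc fw /cfg_gt0P[r' er']]]].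
  move: dij; rewrite ei ej => /(opposite_flank_inj cb l0) ej'.
  rewrite ej' in ej; rewrite {}ej in fc fw; case/cfg_gt0P: fc => rc erc.
  exists i, r'; split=> //; first exact: (inv_side I).
    by rewrite -(inv_side I erc).
  by rewrite er'.
rewrite negb_or => /andP[_ nbl] tw; split; [by right | split].
  by move=> e; case/and3P: tw => _; rewrite e ltnn.
move=> i ei ej _ r'; apply/negP => fr'; case/negP: nbl; apply/andP; split.
  by rewrite ei; apply/(flankP cb); exists i.
apply/existsP; exists (side b (~~ i)); apply/existsP; exists (st.1 r').
rewrite ei (opposite_flank cb) eqxx fr'; apply/and5P; split => //.
- by apply/(flankP cb); exists (~~ i).
- by apply/cfg_gt0P; exists (rob (~~ i)).
by apply/cfg_gt0P; exists r'.
Qed.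

Lemma invariant_step st r s : invariant st -> grid_aut s ->
  invariant (step (@gather n) st (r, s)).
Proof.
move=> I hs; have [look1 [_ look2]] := look_spec r I hs.
case: st I look1 look2 => pos pend I /=; set d := s _ => look1 look2.
case: I => /= sq pn tB sd rb lv; case er: (pend r) => [e|].
  have [[hv dv] Fs Ff Fo Fb] := toward_preserves cb (sq r).1 (sq r).2 (pn _ _ er).
  split=> /=.
  - by move=> r'; case: eqP => _ //; exact: sq.
  - move=> r' e'; case: eqP => // _; exact: pn.
  - by case: eqP => // E; apply: Fb; rewrite -E.
  - move=> i r'; case: eqP => [->|_]; last exact: sd.
    by move=> /Fs; exact: sd.
  - by move=> i; case: eqP => // E; apply: Fo; rewrite -E.
  (* Executing a move starts no new departure: it was already pending. Far sides gain no robot, so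
     the old emptiness persists. *)
  move=> i hl hj r'.
  have hl' : leaving pos pend i.
    move: hl; rewrite /leaving; case: eqP => // E [h|[?]] //.
    by right; exists e; rewrite ?E.
  have hj' : pos (rob (~~ i)) = side b (~~ i).
    by move: hj; case: eqP => // -> /Fs.
  have K := lv i hl' hj'.
  by case: eqP => _ //; apply/negP => /Ff; apply/negP.
split=> //=.
- move=> r' e'; case: eqP => [->|_]; last exact: pn.
  by move=> [<-].
(* A look can start a departure only for the robot that looks, and its snapshot is then current. *)
move=> i hl hj r'.
have [|ei] := classic (pos (rob i) <> side b i).
  by move=> ne; apply: lv => //; left.
move/NNPP: ei => ei; case: hl => // -[e']; case: eqP => [E|_].
  move=> [<-] de; apply: look2 => //; rewrite -E //.
  by rewrite ei.
by move=> pe ne; apply: lv => //; right; exists e'.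
Qed.

Lemma step_dist st r s r' : invariant st ->
  (step (@gather n) st (r, s)).1 r' = st.1 r' \/
  gdist ((step (@gather n) st (r, s)).1 r') b < gdist (st.1 r') b.
Proof.
case: st => pos pend I /=; case er: (pend r) => [e|] /=; last by left.
case: eqP => [->|_]; last by left.
by case: (inv_pend I er) => [->|/and3P[_ h _]]; [left | right].
Qed.

(** * Stabilization and gathering in admissible schedules *)

Section Liveness.

Variables (pos0 : 'I_k -> node n) (sched : nat -> 'I_k * {perm node n}).
Hypotheses (I0 : invariant (pos0, fun=> None)) (adm : admissible sched).

Let st t := exec (@gather n) pos0 sched t.

Lemma invariant_exec t : invariant (st t).
Proof.
elim: t => [|t IH] //; rewrite /st /= -/(st t).
have := adm.1 t; case: (sched t) => r s /= hs; exact: invariant_step.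
Qed.

Let total t := \sum_r gdist ((st t).1 r) b.

Lemma gdist_noninc t r : gdist ((st t.+1).1 r) b <= gdist ((st t).1 r) b.
Proof.
have := step_dist (sched t).1 (sched t).2 r (invariant_exec t).
by rewrite -surjective_pairing => -[->|/ltnW].
Qed.

Lemma total_noninc t t' : t <= t' -> total t' <= total t.
Proof.
move=> /subnKC <-; elim: (t' - t) => [|m IH]; first by rewrite addn0.
by apply: leq_trans IH; rewrite addnS; apply: leq_sum => r _; exact: gdist_noninc.
Qed.

(** The sum of distances to [b] never increases, hence is eventually constant; any change of
    position would decrease it strictly. *)
Lemma eventually_constant : exists T, forall t r, T <= t -> (st t).1 r = (st T).1 r.
Proof.
have [T hT] : exists T, forall t, T <= t -> total t = total T.
  suff H m : forall t, total t <= m -> exists T, forall t, T <= t -> total t = total T.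
    exact: (H (total 0) 0).
  elim: m => [|m IH] t le_m; have mono := @total_noninc t.
    by exists t => t' /mono; lia.
  have [[t' [tt' lt]]|none] := classic (exists t', t <= t' /\ total t' < total t).
    by apply: (IH t'); lia.
  exists t => t' tt'; have := mono _ tt'; rewrite leq_eqVlt => /orP[/eqP//|lt].
  by case: none; exists t'.
exists T => t r /subnKC <-; elim: (t - T) => [|m IH]; first by rewrite addn0.
rewrite addnS -{}IH.
have := step_dist (sched (T + m)).1 (sched (T + m)).2 r (invariant_exec (T + m)).
rewrite -surjective_pairing => -[//|lt]; exfalso.
have : total (T + m).+1 < total (T + m); last by rewrite !hT //; lia.
rewrite /total (bigD1 r) //= [X in _ < X](bigD1 r) //= -addSn.
by apply: leq_add => //; apply: leq_sum => r' _; exact: gdist_noninc.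
Qed.

Lemma pend_idle t r : (sched t).1 <> r -> (st t.+1).2 r = (st t).2 r.
Proof.
rewrite /st /=; case: (exec _ _ _ t) => pos pend; case: (sched t) => r' s /= ne.
by case: (pend r') => [e|] /=; case: eqP => // E; case: ne.
Qed.

Section Stable.

Variable T : nat.
Hypothesis stable : forall t r, T <= t -> (st t).1 r = (st T).1 r.

(** Taking the first activation from [t] on keeps the pending move unchanged. *)
Lemma next_activation t r : non_crashed sched r ->
  exists t', [/\ t <= t', (sched t').1 = r & (st t').2 r = (st t).2 r].
Proof.
move=> /(_ t)[t' [/subnKC E e]]; rewrite -E in e.
move: (t' - t) {E} e => m e; elim: m t e => [|m IH] t e; first by exists t; rewrite addn0 in e.
have [er|ner] := classic ((sched t).1 = r); first by exists t.
rewrite addnS -addSn in e; have [t'' [h1 h2 h3]] := IH _ e.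
by exists t''; split=> //; [exact: ltnW | rewrite h3 pend_idle].
Qed.

Lemma pend_stays t r d : T <= t -> non_crashed sched r -> (st t).2 r = Some d ->
  d = (st T).1 r.
Proof.
move=> Tt nc pd; have [t' [tt' er pd']] := next_activation t nc.
rewrite -(@stable t'.+1) ?(leq_trans Tt) ?(leqW tt') // /st /= -/(st t').
move: pd'; rewrite pd; case: (st t') er => pos pend; case: (sched t') => r' s /= -> ->.
by rewrite /= eqxx.
Qed.

Lemma stable_blocked r : non_crashed sched r -> (st T).1 r <> b ->
  exists i r', [/\ r = rob i, (st T).1 r = side b i,
    (st T).1 (rob (~~ i)) = side b (~~ i) &
    far_side b (side b (~~ i)) ((st T).1 r')].
Proof.
move=> nc nb.
(* If the next activation is a Move, the one after it is a Look. *)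
have [t [Tt er pn]] : exists t, [/\ T <= t, (sched t).1 = r & (st t).2 r = None].
  have [t [Tt er pt]] := next_activation T nc.
  case e: ((st t).2 r) => [d|]; last by exists t.
  have e' : (st t.+1).2 r = None.
    move: e er; rewrite /st /=; case: (exec _ _ _ t) => pos pend.
    by case: (sched t) => r' s /= + -> => -> /=; rewrite eqxx.
  have [t' [h1 h2 h3]] := next_activation t.+1 nc.
  by exists t'; split=> //; [lia | rewrite h3].
have [_ [+ _]] := look_spec r (invariant_exec t) (adm.1 t).
rewrite !stable //; set d := (sched t).2 _ => H.
have pd : (st t.+1).2 r = Some d.
  move: pn er; rewrite /d -(stable r Tt) /st /=; case: (exec _ _ _ t) => pos pend /=.
  by case: (sched t) => r' s /= + -> => -> /=; rewrite eqxx.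
have {H} := H (pend_stays (leqW Tt) nc pd) nb.
by move=> [i [r' [h1 h2 h3 h4]]]; exists i, r'; rewrite !stable // in h3 h4.
Qed.

Lemma stable_gathered r : non_crashed sched r -> (st T).1 r = b.
Proof.
move=> nc; apply: NNPP => nb.
(* A live robot away from [b] must wait on a flank, and a far side contains no flank. *)
have far_crashed i r' : far_side b (side b i) ((st T).1 r') -> ~ non_crashed sched r'.
  move=> fr nc'; have nb' : (st T).1 r' <> b.
    move=> e; have [hs _] := inv_square (invariant_exec T) r'.
    by move: fr; rewrite far_sideE // e; case: i => /=; rewrite ?dxx ?dyy; lia.
  have [j [_ [_ ej _ _]]] := stable_blocked nc' nb'.
  exact: (far_side_neq cb fr ej).
have [i [r1 [_ _ ej f1]]] := stable_blocked nc nb.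
have c1 := far_crashed _ _ f1.
(* The single crash is used up by [r1], which is not on a flank. *)
have ncj : non_crashed sched (rob (~~ i)).
  apply: NNPP => cj; have E := adm.2 _ _ cj c1.
  by apply: (far_side_neq cb f1 (j := ~~ i)); rewrite -E.
have nbj : (st T).1 (rob (~~ i)) <> b by rewrite ej; exact: side_neq_target l0.
have [j [r2 [_ ej' _ f2]]] := stable_blocked ncj nbj.
have c2 := far_crashed _ _ f2; have E := adm.2 _ _ c1 c2.
have ji : j = ~~ i.
  apply: (opposite_flank_inj cb l0); rewrite -ej' ej; exact: opposite_flank.
move: f2; rewrite -E ji => f2.
by have := far_side_disjoint cb f1; rewrite f2.
Qed.

End Stable.

Lemma eventually_gathered : exists T, forall t, T <= t ->
  forall r, non_crashed sched r -> (st t).1 r = b.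
Proof.
have [T stable] := eventually_constant; exists T => t Tt r nc.
by rewrite stable // (stable_gathered stable).
Qed.

End Liveness.
End Execution.

(** * From three occupied corners to the initial invariant *)

Lemma invariant_init n k (pos0 : 'I_k -> node n) b rB (rob : bool -> 'I_k) :
  injective pos0 -> corner b -> pos0 rB = b -> (forall i, pos0 (rob i) = side b i) ->
  (forall r, in_square b (pos0 r)) ->
  (forall r, ~ (dx b (pos0 r) = ell b /\ dy b (pos0 r) = ell b)) ->
  invariant b rB rob (pos0, fun=> None).
Proof.
move=> inj cb eB es sq nD; split=> //=.
- move=> r; split=> //; have [h1 h2] := dxy_le cb (sq r); have h3 := nD r.
  by rewrite gdist_target; lia.
- by move=> i r; rewrite -es => /inj.
- by move=> i; rewrite es; case: (side_rel cb i).
- by move=> i [|[]] //.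
Qed.

Lemma gatherable_from_corner n k (pos0 : 'I_k -> node n) b rB (rob : bool -> 'I_k) :
  ~~ odd n -> injective pos0 -> corner b -> pos0 rB = b ->
  (forall i, pos0 (rob i) = side b i) ->
  (forall r, in_square b (pos0 r)) ->
  (forall r, ~ (dx b (pos0 r) = ell b /\ dy b (pos0 r) = ell b)) ->
  gatherable_1crash pos0.
Proof.
move=> n_even inj cb eB es sq nD; exists (@gather n); split; first exact: gather_valid.
move=> sched adm; have I0 := invariant_init inj cb eB es sq nD.
have rBrob i : rB <> rob i.
  by move=> e; apply: (side_neq_target cb (i := i) (ell_gt0 b n_even)); rewrite -es -e.
have [T h] := eventually_gathered n_even cb rBrob I0 adm.
by exists T, b.
Qed.

Lemma mes_margin_le n k (pos : 'I_k -> node n) r :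
  mes_margin pos <= border_dist (pos r).
Proof.
rewrite /mes_margin; have := mem_index_enum r.
elim: (index_enum _) => // x l IH; rewrite inE big_cons geq_min.
by case/orP => [/eqP->|/IH->]; rewrite ?leqnn ?orbT.
Qed.

Lemma corner_of_coord n m (b : node n) : m <= border_dist b ->
  (b.1 = m :> nat \/ b.1 = n.-1 - m :> nat) -> (b.2 = m :> nat \/ b.2 = n.-1 - m :> nat) ->
  corner b /\ border_dist b = m.
Proof.
move=> h; have [h1 h2 h3 h4] := depth_coord h; move: h; rewrite /corner /border_dist.
clear -h1 h2 h3 h4; move: (nat_of_ord b.1) (nat_of_ord b.2) h1 h2 h3 h4 => x y.
move=> h1 h2 h3 h4 h [] ex [] ey; subst; split; lia.
Qed.

Lemma gatherable_three_corners n k (pos0 : 'I_k -> node n) (rB r1 r2 : 'I_k) :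
  let m := mes_margin pos0 in let b := pos0 rB in
  ~~ odd n -> injective pos0 ->
  (b.1 = m :> nat \/ b.1 = n.-1 - m :> nat) ->
  (b.2 = m :> nat \/ b.2 = n.-1 - m :> nat) ->
  (pos0 r1).1 = n.-1 - b.1 :> nat -> (pos0 r1).2 = b.2 :> nat ->
  (pos0 r2).1 = b.1 :> nat -> (pos0 r2).2 = n.-1 - b.2 :> nat ->
  (forall r, (pos0 r).1 = n.-1 - b.1 :> nat -> (pos0 r).2 = n.-1 - b.2 :> nat -> False) ->
  gatherable_1crash pos0.
Proof.
move=> m b n_even inj hb1 hb2 e11 e12 e21 e22 nD.
have [cb eb] := corner_of_coord (mes_margin_le pos0 rB) hb1 hb2.
apply: (@gatherable_from_corner _ _ _ b rB (fun i => if i then r1 else r2)) => //.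
- by case; apply: node_eqP => //; rewrite ?e11 ?e22 [RHS]rev_ord_flip.
- by move=> r; rewrite /in_square eb; exact: mes_margin_le.
move=> r [ex ey]; apply: (nD r).
  have [h1 h2 _ _] := depth_coord (mes_margin_le pos0 r); move: ex; rewrite /dx /ell eb.
  by clear -h1 h2 hb1; rewrite -/m in h1 h2 *; lia.
have [_ _ h1 h2] := depth_coord (mes_margin_le pos0 r); move: ey; rewrite /dy /ell eb.
by clear -h1 h2 hb2; rewrite -/m in h1 h2 *; lia.
Qed.

Theorem theorem9 (n k : nat) (pos0 : 'I_k -> node n) :
  ~~ odd n -> 3 <= k -> injective pos0 ->
  n_occupied_corners pos0 = 3 ->
  gatherable_1crash pos0.
Proof.
move=> n_even _ inj; rewrite /n_occupied_corners /=; set m := mes_margin pos0.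
have occP (x y : nat) : reflect (exists r, (pos0 r).1 = x :> nat /\ (pos0 r).2 = y :> nat)
    (occupied_nat pos0 (x, y)).
  apply: (iffP existsP) => -[r]; first by move=> /andP[/eqP ? /eqP ?]; exists r.
  by move=> [e1 e2]; exists r; rewrite /= e1 e2 !eqxx.
(* A robot is needed as witness: with none, the margin would take its default value [n]. *)
have mN (r : 'I_k) : n.-1 - (n.-1 - m) = m.
  have := mes_margin_le pos0 r; rewrite -/m /border_dist => h; rewrite subKn //.
  by have := ltn_ord (pos0 r).1; lia.
(* Of the sixteen occupancy patterns four have count three; the middle corner is the one opposite
   the missing corner. *)
case: (occP _ _) => [[ra [a1 a2]]|A]; case: (occP _ _) => [[rb [b1 b2]]|B];
  case: (occP _ _) => [[rc [c1 c2]]|C]; case: (occP _ _) => [[rd [d1 d2]]|D] //= _.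
- apply: (@gatherable_three_corners _ _ pos0 ra rc rb) => //;
    rewrite -/m ?a1 ?a2 ?mN //; try by [left|right].
  by move=> r *; apply: D; exists r.
- apply: (@gatherable_three_corners _ _ pos0 rb rd ra) => //;
    rewrite -/m ?b1 ?b2 ?mN //; try by [left|right].
  by move=> r *; apply: C; exists r.
- apply: (@gatherable_three_corners _ _ pos0 rc ra rd) => //;
    rewrite -/m ?c1 ?c2 ?mN //; try by [left|right].
  by move=> r *; apply: B; exists r.
apply: (@gatherable_three_corners _ _ pos0 rd rb rc) => //;
    rewrite -/m ?d1 ?d2 ?mN //; try by [left|right].
by move=> r *; apply: A; exists r.
Qed.
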